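(* Let $B=[a,b]\times[c,d]\subset\mathbb{R}^2$ be a rectangle with sides parallel to the coordinate axes. The mapping $\Phi\colon \mathcal{M}_B^{hv}\to C(B)$, $L\mapsto f_L$ (restricted to $B$), is continuous, where $\mathcal{M}_B^{hv}$ is equipped with the Hausdorff metric and the function space is equipped with the norm $\|f\|_{1,B}:=\int_B|f(x,y)|\,dx\,dy$.
   Context: Here $a<b$ and $c<d$. A set $K\subset\mathbb{R}^2$ is hv-convex if its intersection with every horizontal line and with every vertical line is convex. $\mathcal{M}_B^{hv}$ denotes the collection of all non-empty compact connected hv-convex sets $L\subset\mathbb{R}^2$ whose axis parallel bounding box (the intersection of all axis parallel boxes containing $L$, possibly degenerate) is contained in $B$. For a compact set $K\subset\mathbb{R}^2$ the generalized conic function $f_K\colon\mathbb{R}^2\to\mathbb{R}$ is $f_K(x,y):=\int_K \big(|x-\alpha|+|y-\beta|\big)\,d\alpha\, d\beta$ (Lebesgue integral). $C(B)$ is the vector space of continuous real functions on $B$. The Hausdorff metric is taken with respect to the Euclidean distance. *)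

(* Defs.v *)
From HB Require Import structures.
From mathcomp Require Import all_boot all_order all_algebra.
From mathcomp Require Import all_classical all_reals all_analysis.

Set Implicit Arguments.
Unset Strict Implicit.
Unset Printing Implicit Defensive.

Import Order.TTheory GRing.Theory Num.Theory.
Import numFieldNormedType.Exports.

Local Open Scope classical_set_scope.
Local Open Scope ring_scope.

Definition rectangle (R : realType) (a b c d : R) : set (R * R) :=
  `[a, b] `*` `[c, d].

(* Degenerate boxes (segments and points) are allowed. *)
Definition is_box (R : realType) (Q : set (R * R)) : Prop :=
  exists a b c d : R, [/\ a <= b, c <= d & Q = rectangle a b c d].

Definition bounding_box (R : realType) (L : set (R * R)) : set (R * R) :=
  \bigcap_(Q in [set Q | is_box Q /\ L `<=` Q]) Q.

Definition hv_convex (R : realType) (K : set (R * R)) : Prop :=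
  (forall y : R, convex_set (K `&` [set p | p.2 = y])) /\
  (forall x : R, convex_set (K `&` [set p | p.1 = x])).

Definition hv_sets (R : realType) (B : set (R * R)) : set (set (R * R)) :=
  [set L | [/\ L !=set0, compact L, connected L, hv_convex L &
               bounding_box L `<=` B]].

(* The norm of the library on [R * R] is the maximum norm, hence the explicit
   Euclidean distance. *)
Definition euclidean_dist (R : realType) (p q : R * R) : R :=
  Num.sqrt ((p.1 - q.1) ^+ 2 + (p.2 - q.2) ^+ 2).

Definition dist_to_set (R : realType) (p : R * R) (K : set (R * R)) : R :=
  inf [set euclidean_dist p q | q in K].

(* [sup] and [inf] are real-valued, so this is meaningful only for non-empty
   bounded sets. *)
Definition hausdorff_dist (R : realType) (K L : set (R * R)) : R :=
  Num.max (sup [set dist_to_set p L | p in K])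
          (sup [set dist_to_set q K | q in L]).

Definition lebesgue2 (R : realType) :
    {measure set (measurableTypeR R * measurableTypeR R) -> \bar R} :=
  (@lebesgue_measure R \x @lebesgue_measure R)%E.

Arguments lebesgue2 : clear implicits.

(* These are the real-valued integrals of the library, which return 0 when the
   extended-valued integral is infinite; this does not happen for a compact [K],
   nor for [f] continuous on a compact [B]. *)
Definition generalized_conic (R : realType) (K : set (R * R)) (p : R * R) : R :=
  \int[lebesgue2 R]_(q in K) (`|p.1 - q.1| + `|p.2 - q.2|).

Definition L1_norm (R : realType) (B : set (R * R)) (f : R * R -> R) : R :=
  \int[lebesgue2 R]_(p in B) `|f p|.

(* Functions on [R * R] are identified with their restrictions to [B]. *)
Definition continuous_on (R : realType) (B : set (R * R)) :
    set (R * R -> R) :=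
  [set f | {within B, continuous f}].

Definition metric_continuous (R : realType) (X Y : Type) (A : set X)
    (dX : X -> X -> R) (dY : Y -> Y -> R) (F : X -> Y) : Prop :=
  forall x, A x -> forall e : R, 0 < e ->
  exists2 delta : R, 0 < delta &
    forall x', A x' -> dX x x' < delta -> dY (F x) (F x') < e.

(* Main.v *)
Require Import Defs.
From HB Require Import structures.
From mathcomp Require Import all_boot all_order all_algebra.
From mathcomp Require Import all_classical all_reals all_analysis.
From mathcomp Require Import measurable_realfun ring lra.

Import Order.TTheory GRing.Theory Num.Theory.
Import numFieldNormedType.Exports.

Local Open Scope classical_set_scope.
Local Open Scope ring_scope.

Set Implicit Arguments.
Unset Strict Implicit.
Unset Printing Implicit Defensive.

(** The integrand of a generalized conic function is at most
    M = (b - a) + (d - c) on B, so for p in B the values f_K(p) and f_L(p)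
    differ by at most M times the area of the symmetric difference of K and L
    ([conic_dist_set]).  Everything thus reduces to showing that the area of the
    symmetric difference tends to 0 when K is fixed and L tends to K in the
    Hausdorff distance.

    One half holds for all compact sets: L \ K lies in K_r \ K, where K_r is
    the r-neighbourhood of K, and the sets K_r \ K decrease to the empty set
    since K is closed ([thickening_measure_shrinks]).  The other half fails in
    general, as finite sets of area 0 approximate every compact set; this is
    where hv-convexity and connectedness of L come in: for a point p outside L,
    some closed quadrant with apex p misses L ([missed_quadrant]).  Moving p by r
    along both axes into that quadrant gives a point at distance at least r from
    L, which cannot belong to K if K is within r of L.  Hence K \ L is covered
    by the four sets K \ (K - v) with v = (+-r, +-r) ([missed_sub_translates]).
    Since K and K - v have the same area, K \ (K - v) and (K - v) \ K do too,
    and the latter lies in K_2r \ K ([translate_defect_measure]).  So the area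
    of K \ L, like that of L \ K, is controlled by a neighbourhood of K alone.

    That f_K is continuous is immediate: it is Lipschitz for the taxicab metric,
    with the area of K as constant ([conic_lipschitz]). *)

(** * Hausdorff distance and neighbourhoods *)

(** The balls of the product are open squares, so this is the comparison of the
    maximum norm with the Euclidean one; everything after the Hausdorff distance
    is expressed with squares. *)
Lemma euclidean_dist_ball (R : realType) (p q : R * R) (e : R) :
  euclidean_dist p q < e -> ball p e q.
Proof.
have le_eucl (x y : R) : `|x| <= Num.sqrt (x ^+ 2 + y ^+ 2).
  by rewrite -sqrtr_sqr ler_sqrt ?addr_ge0 ?sqr_ge0// lerDl sqr_ge0.
move=> pqe; split; apply: le_lt_trans pqe; rewrite /euclidean_dist.
  exact: (le_eucl (p.1 - q.1)).
by rewrite [X in Num.sqrt X]addrC; exact: (le_eucl (p.2 - q.2)).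
Qed.

Lemma dist_to_set_lt (R : realType) (p : R * R) (L : set (R * R)) (e : R) :
  L !=set0 -> dist_to_set p L < e -> exists2 q, L q & ball q e p.
Proof.
move=> [q0 Lq0] /inf_lt[|_ [q Lq <-] pqe].
  by exists (euclidean_dist p q0), q0.
by exists q => //; apply/ball_sym/euclidean_dist_ball.
Qed.

Definition thickening (R : realType) (K : set (R * R)) (e : R) : set (R * R) :=
  \bigcup_(q in K) ball q e.

(** A real-valued supremum bounds its set only when that set is bounded; this
    supplies the boundedness for the two suprema of the Hausdorff distance. *)
Lemma dist_to_set_bounded (R : realType) (K L : set (R * R)) :
  L !=set0 -> bounded_set K -> has_ubound [set dist_to_set p L | p in K].
Proof.
move=> [q Lq] /pinfty_ex_gt0[M M0 KM].
exists (Num.sqrt ((M + `|q.1|) ^+ 2 + (M + `|q.2|) ^+ 2)) => _ [p Kp <-].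
have pM : `|p| <= M by exact: KM.
apply: (@le_trans _ _ (euclidean_dist p q)).
  apply: ge_inf; last by exists q.
  by exists 0 => _ [? _ <-]; exact: sqrtr_ge0.
have sqr_le (x y : R) : `|x| <= M -> (x - y) ^+ 2 <= (M + `|y|) ^+ 2.
  move=> xM; rewrite -[leLHS]real_normK ?num_real// lerXn2r ?nnegrE//.
    by rewrite addr_ge0// (le_trans _ xM).
  by rewrite (le_trans (ler_normB _ _))// lerD2r.
have [p1M p2M] : `|p.1| <= M /\ `|p.2| <= M.
  by move: pM; rewrite prod_normE ge_max => /andP[].
by rewrite ler_sqrt ?addr_ge0 ?sqr_ge0// lerD// sqr_le.
Qed.

Lemma hausdorff_dist_thickening (R : realType) (K L : set (R * R)) (e : R) :
  K !=set0 -> L !=set0 -> bounded_set K -> bounded_set L ->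
  hausdorff_dist K L < e -> K `<=` thickening L e /\ L `<=` thickening K e.
Proof.
move=> K0 L0 bK bL; rewrite /hausdorff_dist gt_max => /andP[KLe LKe].
split=> p pK; apply: dist_to_set_lt => //.
  apply: le_lt_trans KLe; apply: ub_le_sup; last by exists p.
  exact: dist_to_set_bounded.
apply: le_lt_trans LKe; apply: ub_le_sup; last by exists p.
exact: dist_to_set_bounded.
Qed.

(** * Quadrants missed by an hv-convex set *)

Lemma convex_segment (R : realType) (A : set (R * R)) (p q r : R * R) (t : R) :
  convex_set A -> A p -> A q -> 0 <= t -> t <= 1 ->
  r.1 = t * p.1 + (1 - t) * q.1 -> r.2 = t * p.2 + (1 - t) * q.2 -> A r.
Proof.
move=> cA Ap Aq t0 t1 r1 r2.
have := cA p q (Itv01 t0 t1) (mem_set Ap) (mem_set Aq).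
rewrite inE; congr (A _).
by rewrite [RHS]surjective_pairing r1 r2.
Qed.

(** The closed quadrant with apex [p]; the bits are the signs of its two
    directions, [false] standing for the positive one. *)
Definition quadrant (R : realType) (s1 s2 : bool) (p : R * R) : set (R * R) :=
  [set q | 0 <= (-1) ^+ s1 * (q.1 - p.1) /\ 0 <= (-1) ^+ s2 * (q.2 - p.2)].

Lemma hv_convex_between (R : realType) (K : set (R * R)) (p q r : R * R) :
  hv_convex K -> K p -> K q ->
  (p.2 = r.2 /\ q.2 = r.2 /\ p.1 <= r.1 <= q.1) \/
  (p.1 = r.1 /\ q.1 = r.1 /\ p.2 <= r.2 <= q.2) -> K r.
Proof.
have between (x y z : R) : x <= z <= y ->
    exists2 t, 0 <= t <= 1 & z = t * x + (1 - t) * y.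
  move=> /andP[xz zy]; have [yx|xy] := leP y x.
    by exists 1; [rewrite ler01 lexx|lra].
  have yx0 : 0 < y - x by rewrite subr_gt0.
  exists ((y - z) / (y - x)).
    by rewrite divr_ge0 ?subr_ge0 ?(ltW xy)//= ler_pdivrMr//; lra.
  by field; rewrite gt_eqF.
move=> [hK vK] Kp Kq [[p2 [q2 /between[t /andP[t0 t1] r1]]]|
                      [p1 [q1 /between[t /andP[t0 t1] r2]]]].
  have [] // : (K `&` [set p | p.2 = r.2]) r.
  apply: (convex_segment (hK r.2) _ _ t0 t1 r1) => //.
  by rewrite p2 q2; lra.
have [] // : (K `&` [set p | p.1 = r.1]) r.
apply: (convex_segment (vK r.1) _ _ t0 t1 _ r2) => //.
by rewrite p1 q1; lra.
Qed.

(** The sign [s] is the direction of a closed ray from [z] that avoids [A]. *)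
Lemma missed_ray (R : realType) (A : set R) (z : R) :
  (forall x y, A x -> A y -> x <= z <= y -> False) ->
  exists s : bool, forall x, A x -> (-1) ^+ s * (x - z) < 0.
Proof.
move=> Az; have [[y [Ay zy]]|noy] := pselect (exists y, A y /\ z <= y).
  exists true => x Ax; rewrite expr1 mulN1r oppr_lt0 subr_gt0.
  by rewrite ltNge; apply/negP => xz; apply: (Az x y) => //; rewrite xz.
exists false => x Ax; rewrite expr0 mul1r subr_lt0.
by rewrite ltNge; apply/negP => zx; apply: noy; exists x.
Qed.

(** By hv-convexity, [K] misses a horizontal and a vertical ray from [p].  The
    closed quadrant between these two rays and its interior have the same
    intersection with [K], which is therefore relatively open and closed in [K].
    By connectedness it is empty, or it is all of [K]; in the latter case [K]
    lies in an open quadrant and misses the other closed ones. *)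
Lemma missed_quadrant (R : realType) (K : set (R * R)) (p : R * R) :
  connected K -> hv_convex K -> ~ K p ->
  exists s1 s2 : bool, K `&` quadrant s1 s2 p = set0.
Proof.
move=> cK hvK Kp.
have [s1 hs1] : exists s : bool,
    forall x, K (x, p.2) -> (-1) ^+ s * (x - p.1) < 0.
  apply: (missed_ray (A := [set x | K (x, p.2)])) => x y Kx Ky xpy.
  by apply: Kp; apply: (hv_convex_between hvK Kx Ky); left.
have [s2 hs2] : exists s : bool,
    forall y, K (p.1, y) -> (-1) ^+ s * (y - p.2) < 0.
  apply: (missed_ray (A := [set y | K (p.1, y)])) => x y Kx Ky xpy.
  by apply: Kp; apply: (hv_convex_between hvK Kx Ky); right.
have [|/eqP/set0P K0] := pselect (K `&` quadrant s1 s2 p = set0).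
  by exists s1, s2.
pose C : set (R * R) :=
  [set q | 0 < (-1) ^+ s1 * (q.1 - p.1)] `&`
  [set q | 0 < (-1) ^+ s2 * (q.2 - p.2)].
have KC : K `&` quadrant s1 s2 p = K `&` C.
  apply/seteqP; split=> -[x y] /= [Kq [q1 q2]]; split=> //;
    last by split; exact: ltW.
  split; rewrite /= lt_neqAle ?q1 ?q2 andbT eq_sym mulf_neq0 ?signr_eq0//;
    rewrite subr_eq0;
    apply/eqP => qp; move: Kq; rewrite qp.
    by move=> /hs2; rewrite ltNge q2.
  by move=> /hs1; rewrite ltNge q1.
have c1 s (z : R) : continuous (fun q : R * R => (-1) ^+ s * (q.1 - z)).
  move=> q; apply: cvgM; first exact: cvg_cst.
  by apply: cvgB; [exact: cvg_fst|exact: cvg_cst].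
have c2 s (z : R) : continuous (fun q : R * R => (-1) ^+ s * (q.2 - z)).
  move=> q; apply: cvgM; first exact: cvg_cst.
  by apply: cvgB; [exact: cvg_snd|exact: cvg_cst].
have /seteqP[_ KsC] : K `&` quadrant s1 s2 p = K.
  apply: cK => //.
    exists C => //; apply: openI.
      exact: (open_comp (in1W (c1 s1 p.1)) (@open_gt R 0)).
    exact: (open_comp (in1W (c2 s2 p.2)) (@open_gt R 0)).
  exists (quadrant s1 s2 p) => //; apply: closedI.
    exact: (preimage_closed (in1W (c1 s1 p.1)) (@closed_ge R 0)).
  exact: (preimage_closed (in1W (c2 s2 p.2)) (@closed_ge R 0)).
exists (~~ s1), s2; rewrite -subset0 => q [Kq [q1 _]].
have : (K `&` C) q by rewrite -KC; exact: KsC.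
by move=> [_ [/= +  _]]; move: q1; rewrite signrN mulNr; lra.
Qed.

(** * Borel sets and Lebesgue measure of the plane *)

(** [plane R] is convertible to [R * R], but the structure inferred for the latter
    has another display than the one over which [lebesgue2] is defined. *)
Local Notation plane R := (measurableTypeR R * measurableTypeR R)%type.

(** Squares with rational centre and radius [1 / (n + 1)] form a countable base,
    so an open set is a countable union of measurable rectangles. *)
Lemma open_measurable_prod (R : realType) (U : set (R * R)) :
  open U -> measurable (U : set (plane R)).
Proof.
move=> oU.
pose e (n : nat) : R := n.+1%:R^-1.
pose b (x y : rat) n : set (R * R) := ball ((ratr x, ratr y) : R * R) (e n).
have -> : U =
    \bigcup_x \bigcup_y \bigcup_(n in [set n | b x y n `<=` U]) b x y n.
  apply/seteqP; split=> [p Up|p [x _ [y _ [n bU]]]]; last exact: bU.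
  have /nbhs_ballP[r /= r0 rU] : nbhs p U by exact: open_nbhs_nbhs.
  have [n nr] : exists n, e n + e n < r.
    have r20 : 0 < r / 2 by rewrite divr_gt0.
    have [n _ /(_ _ (leqnn n)) nr] := near_infty_natSinv_lt (PosNum r20).
    by exists n; rewrite [ltRHS]splitr ltrD.
  have rat_near (z : R) : exists x : rat, ball (ratr x : R) (e n) z.
    have [] := @dense_rat R (ball z (e n)).
    - by exists z; apply: ballxx; rewrite invr_gt0.
    - exact: ball_open.
    by move=> y [/ball_sym zy [x _ xE]]; exists x; rewrite xE.
  have [x px] := rat_near p.1; have [y py] := rat_near p.2.
  have bp : b x y n p by [].
  exists x => //; exists y => //; exists n => //= q bq.
  apply: rU; apply: le_ball (ltW nr) _ _.
  by apply: ball_triangle bq; exact: ball_sym.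
apply: bigcupT_measurable_rat => x; apply: bigcupT_measurable_rat => y.
apply: bigcup_measurable => n _.
by apply: measurableX; apply: open_measurable; exact: ball_open.
Qed.

Lemma closed_measurable_prod (R : realType) (A : set (R * R)) :
  closed A -> measurable (A : set (plane R)).
Proof.
by move=> /closed_openC/open_measurable_prod/measurableC; rewrite setCK.
Qed.

Lemma compact_measurable_prod (R : realType) (A : set (R * R)) :
  compact A -> measurable (A : set (plane R)).
Proof.
by move=> cA; apply: closed_measurable_prod; apply: compact_closed.
Qed.

Lemma continuous_measurable_prod (R : realType) (f : R * R -> R) :
  continuous f -> measurable_fun [set: plane R] f.
Proof.
move=> /continuousP cf; apply: (measurability _ (RGenOpens.measurableE R)).
move=> _ [_ [x [y ->] <-]]; rewrite setTI.
by apply: open_measurable_prod; apply: cf; exact: interval_open.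
Qed.

Lemma lebesgue_measure_translate (R : realType) (v : R)
    (A : set (measurableTypeR R)) : measurable A ->
  lebesgue_measure ((fun x => x + v) @^-1` A) = lebesgue_measure A.
Proof.
move=> mA; rewrite -[LHS]/(pushforward lebesgue_measure
  ((fun x => x + v) : _ -> measurableTypeR R) A).
apply/esym/lebesgue_measure_unique => //=.
  by apply: measurable_funD.
move=> _ _ [[x y]] _ <-; rewrite /pushforward.
have -> : (fun z => z + v) @^-1` `]x, y] = `]x - v, y - v]%classic.
  by apply/seteqP; split=> z; rewrite /= !in_itv/= ltrBlDr lerBrDr.
by rewrite !lebesgue_measure_itv/= !lte_fin ltrD2r -!EFinB opprB addrA subrK.
Qed.

Lemma lebesgue2_setX (R : realType) (A B : set (measurableTypeR R)) :
  measurable A -> measurable B ->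
  lebesgue2 R (A `*` B) = (lebesgue_measure A * lebesgue_measure B)%E.
Proof. exact: product_measure1E. Qed.

Lemma lebesgue2_translate (R : realType) (v : R * R) (A : set (plane R)) :
  measurable A -> lebesgue2 R ((fun p => p + v) @^-1` A) = lebesgue2 R A.
Proof.
move=> mA.
pose f (p : plane R) : plane R :=
  (p.1 + v.1, p.2 + v.2).
rewrite -[LHS]/(pushforward (lebesgue2 R) f A).
apply/esym/product_measure_unique => //=.
  apply: measurable_fun_pair.
    exact: (measurable_funD measurable_fst (measurable_cst v.1)).
  exact: (measurable_funD measurable_snd (measurable_cst v.2)).
move=> _ X Y mX mY; rewrite /pushforward.
have -> : f @^-1` (X `*` Y) =
    ((fun x => x + v.1) @^-1` X) `*` ((fun y => y + v.2) @^-1` Y) by [].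
have mshift (z : R) (Z : set (measurableTypeR R)) :
    measurable Z -> measurable ((fun x => x + z) @^-1` Z).
  move=> mZ; rewrite -[X in measurable X]setTI.
  have mf : measurable_fun [set: measurableTypeR R] (fun x => x + z).
    exact: measurable_funD.
  exact: mf.
rewrite !lebesgue2_setX//; [|exact: mshift|exact: mshift].
by rewrite !lebesgue_measure_translate.
Qed.

Lemma lebesgue2_bounded (R : realType) (A : set (plane R)) :
  measurable A -> bounded_set A -> (lebesgue2 R A < +oo)%E.
Proof.
move=> mA /pinfty_ex_gt0[M M0 AM].
have sM : A `<=` `[- M, M] `*` `[- M, M].
  move=> p /AM; rewrite /= prod_normE ge_max => /andP[p1 p2].
  by rewrite /= !in_itv/= -!ler_norml.
apply: (@le_lt_trans _ _ (lebesgue2 R (`[- M, M] `*` `[- M, M]))).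
  by apply: le_measure; rewrite ?inE//; apply: measurableX;
    exact: measurable_itv.
rewrite lebesgue2_setX ?lebesgue_measure_itv//=.
by rewrite lte_mul_pinfty//; case: ifP => // _;
  rewrite -EFinB ?ltry// lee_fin; lra.
Qed.

Lemma thickening_le (R : realType) (K : set (R * R)) (e1 e2 : R) :
  e1 <= e2 -> thickening K e1 `<=` thickening K e2.
Proof. by move=> e12 p [q Kq qp]; exists q => //; exact: le_ball qp. Qed.

Lemma open_thickening (R : realType) (K : set (R * R)) (e : R) :
  open (thickening K e).
Proof. by apply: bigcup_open => q _; exact: ball_open. Qed.

Lemma bounded_thickening (R : realType) (K : set (R * R)) (e : R) :
  bounded_set K -> bounded_set (thickening K e).
Proof.
move=> /pinfty_ex_gt0[M M0 KM]; exists (M + e); split; first exact: num_real.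
move=> N MN p [q /KM qM]; rewrite -ball_normE/= => qp.
rewrite -(subrK q p) (le_trans (ler_normD _ _))// (le_trans _ (ltW MN))//.
by rewrite addrC lerD// distrC ltW.
Qed.

(** Continuity from above along the radii [1 / (n + 1)]: a point in all these
    neighbourhoods of [K] is in the closure of [K], hence in [K]. *)
Lemma thickening_measure_shrinks (R : realType) (K : set (R * R)) (e : R) :
  compact K -> 0 < e ->
  exists2 d, 0 < d & (lebesgue2 R (thickening K d `\` K) < e%:E)%E.
Proof.
move=> cK e0; pose F (n : nat) := thickening K n.+1%:R^-1 `\` K.
have mK : measurable (K : set (plane R)).
  exact: compact_measurable_prod.
have mF n : measurable (F n : set (plane R)).
  apply: measurableD => //; apply: open_measurable_prod.
  exact: open_thickening.
have capF : \bigcap_n F n = set0.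
  rewrite -subset0 => p Fp; have [_ nKp] := Fp 0%N I; apply: nKp.
  have /closure_id -> : closed K by apply: compact_closed.
  move=> U /nbhs_ballP[r /= r0 rU].
  have [n _ /(_ _ (leqnn n)) nr] := near_infty_natSinv_lt (PosNum r0).
  have [[q Kq qp] _] := Fp n I; exists q; split=> //.
  by apply: rU; apply/ball_sym; apply: le_ball qp; exact: ltW.
have : (lebesgue2 R) (F n) @[n --> \oo] --> lebesgue2 R (\bigcap_n F n).
  apply: nonincreasing_cvg_mu => //.
  - apply: lebesgue2_bounded => //.
    apply: sub_boundedr (bounded_thickening 1^-1 (compact_bounded cK)).
    by move=> P KP p [Kp _]; exact: KP.
  - by rewrite capF.
  - move=> m n mn; apply/subsetPset; apply: setSD; apply: thickening_le.
    by rewrite lef_pV2 ?posrE// ler_nat.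
rewrite capF measure0 => /(_ [set x | (x < e%:E)%E])[].
  by apply: open_nbhs_nbhs; split;
    [exact: open_ereal_lt_ereal|rewrite /= lte_fin].
by move=> n _ /(_ _ (leqnn n)) Fe; exists n.+1%:R^-1.
Qed.

(** * Area lost by translation, and area of the missed part *)

(** The translate [S] of [K] has the area of [K], which is finite, so [K \ S]
    and [S \ K] have the same area; and [S] lies in a neighbourhood of [K]. *)
Lemma translate_defect_measure (R : realType) (K : set (R * R)) (v : R * R)
    (d : R) :
  compact K -> ball (0 : R * R) d v ->
  (lebesgue2 R (K `\` (fun p : R * R => p + v)%R @^-1` K) <=
   lebesgue2 R (thickening K d `\` K))%E.
Proof.
move=> cK vd; set S := _ @^-1` K.
have cS : closed S.
  apply: preimage_closed; last by apply: compact_closed.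
  by move=> p _; apply: cvgD; [exact: cvg_id|exact: cvg_cst].
have mK : measurable (K : set (plane R)) by exact: compact_measurable_prod.
have mS : measurable (S : set (plane R)) by exact: closed_measurable_prod.
have muS : lebesgue2 R S = lebesgue2 R K by exact: lebesgue2_translate.
have fK : (lebesgue2 R K < +oo)%E.
  by apply: lebesgue2_bounded => //; exact: compact_bounded.
have -> : lebesgue2 R (K `\` S) = lebesgue2 R (S `\` K).
  have fS : (lebesgue2 R S < +oo)%E by rewrite muS.
  rewrite (measureD mK mS fK) (measureD mS mK fS).
  by rewrite setIC; congr (_ - _)%E.
apply: le_measure; rewrite ?inE; [exact: measurableD| |].
  apply: measurableD => //; apply: open_measurable_prod.
  exact: open_thickening.
apply: setSD => p Sp; exists (p + v) => //.
move: vd; rewrite -!ball_normE /= sub0r normrN => vd.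
by rewrite addrAC subrr add0r.
Qed.

(** If [p] is in [K] but the quadrant at [p] with signs [s] misses [L], then
    [p + (s.1 * d, s.2 * d)] is not in [K]: any point of the plane within [d] of
    it, for the maximum norm, is still in the quadrant, hence not in [L]. *)
Lemma missed_sub_translates (R : realType) (K L : set (R * R)) (d : R) :
  connected L -> hv_convex L -> K `<=` thickening L d ->
  K `\` L `<=` \bigcup_(s in [set: bool * bool])
    (K `\` (fun p => p + (((-1) ^+ s.1 * d, (-1) ^+ s.2 * d) : R * R)) @^-1` K).
Proof.
have sgnE (s : bool) (x y : R) :
    ball x d (y + (-1) ^+ s * d) -> 0 <= (-1) ^+ s * (x - y).
  rewrite -ball_normE /= ltr_distl.
  by case: s; rewrite ?expr1 ?expr0 => /andP[xl xr]; lra.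
move=> cL hL KL p [Kp nLp].
have [s1 [s2 Ls]] := missed_quadrant cL hL nLp.
exists (s1, s2) => //; split=> //= Kpv.
have [q Lq [/= q1 q2]] := KL _ Kpv.
suff : (L `&` quadrant s1 s2 p) q by rewrite Ls.
by split=> //; split; exact: sgnE.
Qed.

(** The factor 4 counts the quadrants.  The radius is doubled to leave
    room: the vectors [(+-d, +-d)] have maximum norm [d], and balls are open. *)
Lemma measure_missed (R : realType) (K L : set (R * R)) (d : R) :
  compact K -> compact L -> connected L -> hv_convex L -> 0 < d ->
  K `<=` thickening L d ->
  (lebesgue2 R (K `\` L) <=
   4%:E * lebesgue2 R (thickening K (2 * d) `\` K))%E.
Proof.
move=> cK cL coL hL d0 KL.
have mK : measurable (K : set (plane R)) by exact: compact_measurable_prod.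
have mL : measurable (L : set (plane R)) by exact: compact_measurable_prod.
pose v (s : bool * bool) : R * R := ((-1) ^+ s.1 * d, (-1) ^+ s.2 * d).
pose S s : set (plane R) := K `\` (fun p : R * R => p + v s) @^-1` K.
have mS s : measurable (S s).
  apply: measurableD => //; apply: closed_measurable_prod.
  apply: preimage_closed; last by apply: compact_closed.
  by move=> p _; apply: cvgD; [exact: cvg_id|exact: cvg_cst].
have muS s : (lebesgue2 R (S s) <= lebesgue2 R (thickening K (2 * d) `\` K))%E.
  apply: translate_defect_measure => //; rewrite -ball_normE /= sub0r normrN.
  by rewrite prod_normE gt_max !normrM !normr_sign !mul1r gtr0_norm//=; lra.
pose U := S (true, true) `|` S (true, false) `|`
  (S (false, true) `|` S (false, false)).
have sub : K `\` L `<=` U.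
  by move=> p /(missed_sub_translates coL hL KL)[[[] []] _ Sp];
    [left; left|left; right|right; left|right; right].
have mU : measurable U by apply: measurableU; exact: measurableU.
apply: (@le_trans _ _ (lebesgue2 R U)).
  by apply: le_measure; rewrite ?inE//; exact: measurableD.
apply: (le_trans (measureU2 _ _ _)); [exact: measurableU|exact: measurableU|].
have -> : 4%:E = (1 + 1 + (1 + 1) : \bar R)%E.
  by rewrite -!EFinD; congr EFin; ring.
rewrite !ge0_muleDl// ?mul1e ?adde_ge0//.
by apply: leeD; (apply: le_trans; [exact: measureU2|apply: leeD; exact: muS]).
Qed.

(** * Integrals of bounded functions *)

Section integral.
Context d (T : measurableType d) (R : realType).
Context (mu : {measure set T -> \bar R}).

Lemma bounded_integrable (A : set T) (g : T -> R) (M : R) :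
  measurable A -> (mu A < +oo)%E -> measurable_fun A g ->
  (forall x, A x -> `|g x| <= M) -> mu.-integrable A (EFin \o g).
Proof.
move=> mA fA mg gM; apply: measurable_bounded_integrable => //.
exists M; split; first exact: num_real.
by move=> N MN x Ax; apply: le_trans (gM x Ax) (ltW MN).
Qed.

Lemma le_norm_Rintegral_bound (A : set T) (g : T -> R) (M : R) :
  measurable A -> (mu A < +oo)%E -> measurable_fun A g ->
  (forall x, A x -> `|g x| <= M) ->
  `|\int[mu]_(x in A) g x| <= M * fine (mu A).
Proof.
move=> mA fA mg gM; have ig := bounded_integrable mA fA mg gM.
apply: le_trans (le_normr_Rintegral mA ig) _.
rewrite -Rintegral_cst//; apply: le_Rintegral => //.
  exact: integrable_norm.
apply: (@bounded_integrable _ (cst M) M) => // x Ax.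
by rewrite ger0_norm// (le_trans _ (gM x Ax)).
Qed.

(** The contributions of [A `&` B] cancel. *)
Lemma Rintegral_setD (A B : set T) (g : T -> R) :
  measurable A -> measurable B -> mu.-integrable (A `|` B) (EFin \o g) ->
  \int[mu]_(x in A) g x - \int[mu]_(x in B) g x =
  \int[mu]_(x in A `\` B) g x - \int[mu]_(x in B `\` A) g x.
Proof.
move=> mA mB ig.
have split_int (C D : set T) : measurable C -> measurable D -> C `<=` A `|` B ->
    \int[mu]_(x in C) g x =
    \int[mu]_(x in C `\` D) g x + \int[mu]_(x in C `&` D) g x.
  move=> mC mD CAB.
  rewrite -[C in LHS](setUIDK C D) setUC Rintegral_setU//.
  - exact: measurableD.
  - exact: measurableI.
  - apply: integrableS ig; [exact: measurableU| |].
      by apply: measurableU; [exact: measurableD|exact: measurableI].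
    by rewrite setUC setUIDK.
  - rewrite disj_set2E; apply/eqP.
    by rewrite setDE setIACA setIid [~` D `&` D]setICl setI0.
rewrite (split_int A B)// (split_int B A)// [B `&` A]setIC.
by rewrite opprD addrACA subrr addr0.
Qed.

End integral.

Lemma le_fine_EFin (R : realType) (x : \bar R) (r : R) :
  (0 <= x)%E -> (x <= r%:E)%E -> fine x <= r.
Proof. by case: x => [x| |]//=; rewrite lee_fin. Qed.

(** * Generalized conic functions *)

Definition taxicab (R : realType) (p q : R * R) : R :=
  `|p.1 - q.1| + `|p.2 - q.2|.

Section conic.
Context (R : realType).
Implicit Types (K L : set (R * R)) (p q : R * R).

Lemma measurable_taxicab p (K : set (plane R)) : measurable_fun K (taxicab p).
Proof.
apply: (measurable_funS measurableT) => //.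
apply: continuous_measurable_prod => q.
apply: cvgD; apply: cvg_norm; apply: cvgB; try exact: cvg_cst.
  exact: cvg_fst.
exact: cvg_snd.
Qed.

Lemma compact_lebesgue2_lty K : compact K -> (lebesgue2 R K < +oo)%E.
Proof.
by move=> cK; apply: lebesgue2_bounded;
  [exact: compact_measurable_prod|exact: compact_bounded].
Qed.

Lemma integrable_taxicab K p : compact K ->
  (lebesgue2 R).-integrable K (EFin \o taxicab p).
Proof.
move=> cK; have /pinfty_ex_gt0[M M0 KM] := compact_bounded cK.
apply: (@bounded_integrable _ _ _ _ _ _ (`|p.1| + `|p.2| + 2 * M)).
- exact: compact_measurable_prod.
- exact: compact_lebesgue2_lty.
- exact: measurable_taxicab.
move=> q /KM /=; rewrite prod_normE ge_max => /andP[q1 q2].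
rewrite ger0_norm ?addr_ge0// /taxicab.
have := ler_normB p.1 q.1; have := ler_normB p.2 q.2; lra.
Qed.

Lemma conic_dist_set K L p (M : R) : compact K -> compact L ->
  (forall q, (K `|` L) q -> taxicab p q <= M) ->
  `|generalized_conic K p - generalized_conic L p| <=
  M * (fine (lebesgue2 R (K `\` L)) + fine (lebesgue2 R (L `\` K))).
Proof.
move=> cK cL pM.
have mK : measurable (K : set (plane R)) by exact: compact_measurable_prod.
have mL : measurable (L : set (plane R)) by exact: compact_measurable_prod.
have cKL : compact (K `|` L) by exact: compactU.
have bound (A : set (plane R)) : measurable A -> A `<=` K `|` L ->
    `|\int[lebesgue2 R]_(q in A) taxicab p q| <= M * fine (lebesgue2 R A).
  move=> mA AKL; apply: le_norm_Rintegral_bound => //.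
  - apply: le_lt_trans (compact_lebesgue2_lty cKL).
    by apply: le_measure; rewrite ?inE//; exact: measurableU.
  - exact: measurable_taxicab.
  - by move=> q /AKL/pM; rewrite ger0_norm ?addr_ge0.
rewrite /generalized_conic Rintegral_setD//; last exact: integrable_taxicab.
rewrite (le_trans (ler_normB _ _))// mulrDr lerD// bound//.
- exact: measurableD.
- by move=> q []; left.
- exact: measurableD.
- by move=> q []; right.
Qed.

(** Integrate the reverse triangle inequality in each coordinate. *)
Lemma conic_lipschitz K p p' : compact K ->
  `|generalized_conic K p - generalized_conic K p'| <=
  taxicab p p' * fine (lebesgue2 R K).
Proof.
move=> cK.
have mK : measurable (K : set (plane R)) by exact: compact_measurable_prod.
rewrite /generalized_conic -RintegralB//; try exact: integrable_taxicab.
apply: le_norm_Rintegral_bound => //.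
- exact: compact_lebesgue2_lty.
- by apply: measurable_funB; exact: measurable_taxicab.
move=> q _; rewrite opprD addrACA (le_trans (ler_normD _ _))// lerD//.
  by rewrite (le_trans (ler_dist_dist _ _))// opprB addrA subrK.
by rewrite (le_trans (ler_dist_dist _ _))// opprB addrA subrK.
Qed.

Lemma continuous_conic K : compact K -> continuous (generalized_conic K).
Proof.
move=> cK p; apply/cvgrPdist_lt => e e0.
set C := fine (lebesgue2 R K); have C0 : 0 <= C by rewrite fine_ge0.
(* The ball of radius r is a square, of taxicab radius 2 * r; the summand 1
   avoids dividing by 0 when K has area 0. *)
pose r := e / (2 * (C + 1)).
have r0 : 0 < r by rewrite divr_gt0// mulr_gt0//; lra.
have eE : e = 2 * r * (C + 1) by rewrite /r; field; lra.
apply: filterS (nbhsx_ballx p r r0) => q [/= pq1 pq2].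
apply: le_lt_trans (conic_lipschitz _ _ cK) _; rewrite -/C eE.
have : taxicab p q <= 2 * r.
  by rewrite mulr2n mulrDl mul1r; apply: lerD; exact: ltW.
by nra.
Qed.

Lemma L1_norm_bound (B : set (R * R)) (f : R * R -> R) (M : R) :
  compact B -> continuous f -> (forall p, B p -> `|f p| <= M) ->
  L1_norm B f <= M * fine (lebesgue2 R B).
Proof.
move=> cB cf fM; apply: le_trans (ler_norm _) _; apply: le_norm_Rintegral_bound.
- exact: compact_measurable_prod.
- exact: compact_lebesgue2_lty.
- apply: (measurable_funS measurableT) => //.
  apply: continuous_measurable_prod => p.
  by apply: cvg_norm; exact: cf.
- by move=> p /fM; rewrite normr_id.
Qed.

End conic.

Lemma hv_sets_sub (R : realType) (B L : set (R * R)) : hv_sets B L -> L `<=` B.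
Proof. by move=> [_ _ _ _ LB] p Lp; apply: LB => Q [_]; exact. Qed.

Unset Implicit Arguments.

Theorem corollary2 (R : realType) (a b c d : R) (hab : a < b) (hcd : c < d) :
  let B := rectangle a b c d in
  set_fun (hv_sets B) (continuous_on B) (@generalized_conic R) /\
  metric_continuous (hv_sets B) (@hausdorff_dist R)
    (fun f g : R * R -> R => L1_norm B (f \- g)) (@generalized_conic R).
Proof.
move=> B; split=> [K [_ cK _ _ _]|K hK e e0].
  by apply: continuous_subspaceT; exact: continuous_conic.
have [K0 cK _ _ _] := hK.
have cB : compact B by apply: compact_setX; exact: segment_compact.
pose M := (b - a) + (d - c); have M0 : 0 < M by rewrite /M; lra.
pose m := fine (lebesgue2 R B); have m0 : 0 <= m by rewrite fine_ge0.
(* 5 = 4 + 1: the four quadrants for K minus L, and L minus K. *)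
pose e' := e / (5 * M * (m + 1)).
have e'0 : 0 < e' by rewrite divr_gt0// !mulr_gt0//; lra.
have eE : e = M * (5 * e') * (m + 1) by rewrite /e'; field; lra.
have [r r0 Kr] := thickening_measure_shrinks cK e'0.
exists (r / 2); first by rewrite divr_gt0.
move=> L hL KL; have [L0 cL coL hvL _] := hL.
have [KsL LsK] := hausdorff_dist_thickening K0 L0
  (compact_bounded cK) (compact_bounded cL) KL.
have muKL : fine (lebesgue2 R (K `\` L)) <= 4 * e'.
  apply: le_fine_EFin => //.
  apply: le_trans (measure_missed cK cL coL hvL _ KsL) _.
    by rewrite divr_gt0.
  by rewrite mulrCA divff// mulr1 EFinM lee_pmul2l// ltW.
have muLK : fine (lebesgue2 R (L `\` K)) <= e'.
  apply: le_fine_EFin => //; apply: le_trans (ltW Kr).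
  have mK : measurable (K : set (plane R)) by exact: compact_measurable_prod.
  apply: le_measure; rewrite ?inE.
  - by apply: measurableD => //; exact: compact_measurable_prod.
  - apply: measurableD => //; apply: open_measurable_prod.
    exact: open_thickening.
  - apply: setSD => p /LsK; apply: thickening_le; lra.
have near p : B p ->
    `|(generalized_conic K \- generalized_conic L) p| <= M * (5 * e').
  move=> Bp; apply: le_trans (conic_dist_set (M := M) cK cL _) _ => [q KLq|].
    have [/= ] : B q by case: KLq => [/(hv_sets_sub hK)|/(hv_sets_sub hL)].
    move: Bp => [/=]; rewrite !in_itv/= => /andP[p1 p2] /andP[p3 p4].
    move=> /andP[q1 q2] /andP[q3 q4].
    by rewrite /M lerD// ler_norml; lra.
  by rewrite ler_pM2l//; lra.
apply: le_lt_trans (L1_norm_bound cB _ near) _.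
  by move=> p; apply: cvgB; exact: continuous_conic.
by rewrite -/m [ltRHS]eE; have := mulr_gt0 M0 e'0; nra.
Qed.
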